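(* Let $K\ge2$ and $d>0$, and consider, in the limit $n\to\infty$, the discrete system $$u_t=-u+\frac{u^2}{v},\qquad 0=d^2n^2\,\mathcal L v-v+u^2$$ on the cycle with $n$ nodes. If the symmetric $K$-spike solution is unstable, then any equilibrium $K$-spike profile whose spike locations deviate slightly from the symmetric positions is also unstable. That is: for any $s_1,\dots,s_K\in\mathbb R$, all sufficiently small $\sigma>0$, and all sufficiently large admissible $n$, an equilibrium $K$-spike profile with spikes at $x_k+\sigma s_k$, $x_k=(k-1)/K$, $k=1,\dots,K$, and heights close to the symmetric ones is unstable.
   Context: The nodes of the cycle graph with $n$ nodes are identified with the points $x=j/n$, $j\in\mathbb Z/n\mathbb Z$, of the circle $\mathbb R/\mathbb Z$, and $(\mathcal L v)(x)=v(x+\tfrac1n)+v(x-\tfrac1n)-2v(x)$. The parameters $d,K$ do not depend on $n$; $n$ is admissible if all spike locations are nodes. A $K$-spike steady state with spikes at given points is a time-independent solution with $v>0$, $u=v>0$ at the spike points and $u=0$ at all other nodes. The symmetric $K$-spike solution has spikes at $x_k=(k-1)/K$ with all heights equal; to leading order as $n\to\infty$ they are $nV_0$ with $V_0=1/\sum_{j=1}^KG^{per}(x_j,0)$, where $$G^{per}(x,y)=\frac{\cosh\big((l-\tfrac12)/d\big)}{2d\,\sinh\big(1/(2d)\big)},\qquad l=\min(|x-y|,1-|x-y|).$$ The deviating profiles considered have spikes at $y_k=x_k+\sigma s_k$ and heights $u(y_k)=v(y_k)\sim nV_k$ as $n\to\infty$, where $V_k=\sum_{j=1}^KV_j^2G^{per}(y_k,y_j)$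 and $V_k=V_0+O(\sigma)$ as $\sigma\to0$. A steady state $(u_s,v_s)$ is unstable if the linearized problem $$\lambda\phi=-\phi+\frac{2u_s}{v_s}\phi-\frac{u_s^2}{v_s^2}\psi,\qquad 0=d^2n^2\mathcal L\psi-\psi+2u_s\phi$$ has a solution $(\phi,\psi)\neq(0,0)$ for some $\lambda$ with $\operatorname{Re}\lambda>0$; in the limit $n\to\infty$, the symmetric solution being unstable means that this holds to leading order, i.e. the matrix $I-2V_0\,(G^{per}(x_k,x_j))_{k,j=1}^K$ has an eigenvalue with positive real part. *)

(* Defs.v *)
From mathcomp Require Import all_boot all_order all_algebra.
From mathcomp Require Import all_classical all_reals all_analysis.
From mathcomp Require Import complex.

Set Implicit Arguments.
Unset Strict Implicit.
Unset Printing Implicit Defensive.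

Import Order.TTheory GRing.Theory Num.Theory.
Import numFieldNormedType.Exports.

Local Open Scope classical_set_scope.
Local Open Scope ring_scope.
Local Open Scope complex_scope.

(* The cycle graph with n nodes is carried by 'I_n; node i is the point i/n of
   R/Z, and its neighbours are [ordS i] and [ord_pred i]. *)
Definition cycle_lap (T : zmodType) (n : nat) (f : 'I_n -> T) (i : 'I_n) : T :=
  f (ordS i) + f (ord_pred i) - f i *+ 2.

(* x = i/n in R/Z *)
Definition at_point (R : realType) (n : nat) (x : R) (i : 'I_n) : Prop :=
  exists m : int, x = i%:R / n%:R + m%:~R.

Definition admissible (R : realType) (K : nat) (y : 'I_K -> R) (n : nat) : Prop :=
  forall k, exists i : 'I_n, at_point (y k) i.

Section System.
Context (R : realType) (n : nat) (d : R).
Implicit Types u v : 'I_n -> R.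

Definition rhs_u u v (i : 'I_n) : R := - u i + u i ^+ 2 / v i.

Definition rhs_v u v (i : 'I_n) : R :=
  d ^+ 2 * n%:R ^+ 2 * cycle_lap v i - v i + u i ^+ 2.

Definition steady_state u v : Prop :=
  forall i, rhs_u u v i = 0 /\ rhs_v u v i = 0.

Definition spike_steady_state (K : nat) (y : 'I_K -> R) u v : Prop :=
  [/\ steady_state u v,
      forall i, 0 < v i,
      forall k i, at_point (y k) i -> u i = v i
    & forall i, (forall k, ~ at_point (y k) i) -> u i = 0].

Definition has_heights (K : nat) (y h : 'I_K -> R) u : Prop :=
  forall k i, at_point (y k) i -> u i = h k.

Definition unstable u v : Prop :=
  exists (lam : R[i]) (phi psi : 'I_n -> R[i]),
    [/\ 0 < complex.Re lam,
        exists i, (phi i, psi i) != (0, 0),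
        forall i, lam * phi i =
          - phi i + (2 * u i / v i)%:C * phi i - (u i ^+ 2 / v i ^+ 2)%:C * psi i
      & forall i, 0 = (d ^+ 2 * n%:R ^+ 2)%:C * cycle_lap psi i - psi i
                      + (2 * u i)%:C * phi i].

End System.

Section Green.
Context (R : realType).

Definition cosh (x : R) : R := (expR x + expR (- x)) / 2.
Definition sinh (x : R) : R := (expR x - expR (- x)) / 2.

(* x and y are real representatives of points of R/Z; the formula for the
   distance l on the circle requires |x - y| <= 1. *)
Definition Gper (d x y : R) : R :=
  let l := Num.min `|x - y| (1 - `|x - y|) in
  cosh ((l - 1 / 2) / d) / (2 * d * sinh (1 / (2 * d))).

(* The indices k : 'I_K start at 0, so that the K points are k/K. *)
Definition sym_pos (K : nat) (k : 'I_K) : R := k%:R / K%:R.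

Definition sym_height (K : nat) (d : R) : R :=
  1 / \sum_(j < K) Gper d (sym_pos j) 0.

Definition sym_matrix (K : nat) (d : R) : 'M[R]_K :=
  1%:M - (2 * sym_height K d) *: \matrix_(k, j) Gper d (sym_pos k) (sym_pos j).

Definition sym_unstable (K : nat) (d : R) : Prop :=
  exists2 lam : R[i],
    eigenvalue (map_mx (real_complex R) (sym_matrix K d)) lam
    & 0 < complex.Re lam.

Definition dev_pos (K : nat) (s : 'I_K -> R) (sigma : R) (k : 'I_K) : R :=
  sym_pos k + sigma * s k.

(* V sigma k is the leading-order height V_k of the profile with spikes at
   [dev_pos s sigma]. *)
Definition limit_heights (K : nat) (d : R) (s : 'I_K -> R) (V : R -> 'I_K -> R)
    : Prop :=
  (\forall sigma \near 0^'+, forall k,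
     V sigma k = \sum_(j < K) V sigma j ^+ 2
                   * Gper d (dev_pos s sigma k) (dev_pos s sigma j))
  /\ (forall k,
       (fun sigma : R => V sigma k - sym_height K d)
         =O_ (0^'+) (fun sigma : R => sigma)).

End Green.

(* Main.v *)
Require Import Defs.
From mathcomp Require Import all_boot all_order all_algebra.
From mathcomp Require Import all_classical all_reals all_analysis.
From mathcomp Require Import complex zify ring lra.

(** The operator [- d^2 n^2 L + 1] on the cycle has an explicit Green function
[discrete_green], a combination of two powers of the root [r > 1] of
[r + 1/r - 2 = 1/(d n)^2].  In the linearization at a spike profile [phi]
vanishes off the spikes when [lam] differs from [-1], and [psi] is recovered
from [phi] by convolution with this Green function.  Hence every eigenvalue
with positive real part of the [K x K] matrix with entries
[(k == j) - 2 v(p_k) G_n(p_j, p_k)], where [p_k] is the node of the [k]-th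
spike, yields an unstable mode ([unstable_spike_mx]); it is enough to exhibit
[psi], so no uniqueness for the discrete elliptic problem is needed.

When [n] grows, [n G_n] evaluated at nodes representing fixed points [y], [z]
of the circle with [|y - z| < 1] depends only on [n] and [|y - z|]
([discrete_green_at_points]) and tends to [Gper d y z] ([scaled_green_cvg]), while [v(p_k) / n] tends to
[V_k] ([cvg_div_nat]).  So the [K x K] matrix converges to [dev_matrix], built
from the deviating positions and limit heights, and [dev_matrix] in turn
converges to the symmetric matrix when [sigma] tends to [0]
([dev_matrix_cvg]).  Having an eigenvalue with positive real part is an open
condition on matrices ([unstable_mx_open]), so the instability passes from the
symmetric matrix to [dev_matrix] for small [sigma], and from there to the
matrix at finite [n] for large [n].  Small [sigma] also keeps the spikes
distinct on the circle ([dev_pos_separated]). *)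

Import Order.TTheory GRing.Theory Num.Theory.
Import numFieldNormedType.Exports.

Local Open Scope classical_set_scope.
Local Open Scope ring_scope.

Set Implicit Arguments.
Unset Strict Implicit.
Unset Printing Implicit Defensive.

(** * Persistence of unstable eigenvalues *)

Lemma horner_char_poly (F : comNzRingType) (n : nat) (A : 'M[F]_n) (x : F) :
  (char_poly A).[x] = \det (x%:M - A).
Proof.
rewrite -[LHS]/(horner_eval x (char_poly A)) -det_map_mx; congr (\det _).
apply/matrixP => i j; rewrite !mxE /= /horner_eval !hornerE.
by case: (i == j); rewrite ?mulr1n ?mulr0n !hornerE.
Qed.

Lemma cvg_det (C : numFieldType) (n : nat) (T : Type) (F : set_system T)
    (FF : Filter F) (M : T -> 'M[C]_n) (A : 'M[C]_n) :
  (forall i j, M t i j @[t --> F] --> A i j) ->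
  \det (M t) @[t --> F] --> \det A.
Proof.
move=> MA; apply: (@cvg_big C _ +%R); first exact: add_continuous.
move=> p _; apply: cvgM; first exact: cvg_cst.
apply: (@cvg_big C _ *%R); first exact: mul_continuous.
by move=> i _; exact: MA.
Qed.

(** Lower semicontinuity of the spectrum: the monic polynomial [char_poly (M t)]
has degree [n], so if its value at [lam] is smaller than [e ^ n] in modulus, then
one of its [n] roots is closer than [e] to [lam]. *)
Lemma eigenvalue_near (C : numClosedFieldType) (n : nat) (T : Type)
    (F : set_system T) (FF : Filter F) (M : T -> 'M[C]_n) (A : 'M[C]_n)
    (lam e : C) :
  (forall i j, M t i j @[t --> F] --> A i j) ->
  eigenvalue A lam -> 0 < e ->
  \forall t \near F, exists2 mu, eigenvalue (M t) mu & `|lam - mu| < e.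
Proof.
move=> MA; rewrite eigenvalue_root_char => /rootP.
rewrite horner_char_poly => det0 e0.
have : \det (lam%:M - M t) @[t --> F] --> (0 : C).
  rewrite -det0; apply: cvg_det => i j; rewrite !mxE.
  under eq_cvg do rewrite !mxE.
  by apply: cvgB; [exact: cvg_cst|exact: MA].
move=> /cvgr0_norm_lt /(_ (e ^+ n) (exprn_gt0 n e0)).
apply: filterS => t; rewrite -horner_char_poly.
have [r Er] := closed_field_poly_normal (char_poly (M t)).
move: Er; rewrite (monicP (char_poly_monic _)) scale1r => Er.
have sr : size r = n.
  by have := size_char_poly (M t); rewrite Er size_prod_XsubC => -[].
have [[mu mur lt_mu] _|far] := pselect (exists2 mu, mu \in r & `|lam - mu| < e).
  by exists mu => //; rewrite eigenvalue_root_char Er root_prod_XsubC.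
rewrite Er horner_prod normr_prod => small; exfalso; move: small; rewrite -sr.
have {}far mu : mu \in r -> e <= `|('X - mu%:P).[lam]|.
  move=> mur; rewrite !hornerE real_leNgt ?realE ?normr_ge0 ?(ltW e0) //.
  by apply/negP => lt_mu; apply: far; exists mu.
suff /le_lt_trans h : e ^+ size r <= \prod_(mu <- r) `|('X - mu%:P).[lam]|.
  by move=> /h; rewrite ltxx.
elim: r far {Er sr} => [|mu r IHr] far; first by rewrite big_nil.
rewrite big_cons exprS ler_pM ?exprn_ge0 ?(ltW e0) ?far ?mem_head // IHr //.
by move=> nu nur; rewrite far // in_cons nur orbT.
Qed.

(** A real matrix is unstable if it has a complex eigenvalue with positive real
part. *)
Definition unstable_mx (R : realType) (n : nat) (A : 'M[R]_n) : Prop :=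
  exists2 lam : R[i],
    eigenvalue (map_mx (real_complex R) A) lam & 0 < complex.Re lam.

(** Instability is an open condition, here in the entrywise supremum distance. *)
Lemma unstable_mx_open (R : realType) (n : nat) (A0 : 'M[R]_n) :
  unstable_mx A0 ->
  exists2 e : R, 0 < e &
    forall A : 'M[R]_n, (forall i j, `|A0 i j - A i j| < e) -> unstable_mx A.
Proof.
move=> [lam eig0 lam_gt0].
have lamC : 0 < real_complex R (complex.Re lam) by rewrite ltcR.
pose A0C : 'M[R[i]^o]_n := map_mx (real_complex R) A0.
have : \forall A \near A0C,
    exists2 mu : R[i], eigenvalue (A : 'M[R[i]]_n) mu
      & `|lam - mu| < real_complex R (complex.Re lam).
  apply: (eigenvalue_near (nbhs_filter A0C) _ eig0 lamC) => i j.
  exact: coord_continuous.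
move=> /nbhs_ballP[/= e e0 near_eig].
have eR : real_complex R (complex.Re e) = e.
  move: (e0); rewrite ltcE => /andP[/eqP im0 _].
  by apply/eqP; rewrite eq_complex /= eqxx /= im0.
exists (complex.Re e); first by rewrite -ltcR eR.
move=> A dA; have [|mu eig lt_mu] := near_eig (map_mx (real_complex R) A).
  split=> // i j; rewrite !mxE -ball_normE /= -eR.
  by rewrite -rmorphB normc_def /= expr0n addr0 sqrtr_sqr ltcR.
exists mu => //; have := le_lt_trans (normc_ge_Re _) lt_mu.
rewrite raddfB ltcR => /ltr_distlDr; lra.
Qed.

(** * The discrete Green function *)

(** The offset of node [i] from node [j]: the representative of [i - j] modulo
[n] in [0, n - 1]. *)
Definition cycle_offset (n : nat) (j i : 'I_n) : nat := ((i + (n - j)) %% n)%N.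

Lemma cycle_offset_lt (n : nat) (j i : 'I_n) : (cycle_offset j i < n)%N.
Proof. by rewrite ltn_mod (leq_ltn_trans _ (ltn_ord i)). Qed.

Lemma cycle_offset_eq0 (n : nat) (j i : 'I_n) :
  (cycle_offset j i == 0)%N = (i == j).
Proof.
rewrite /cycle_offset -(inj_eq val_inj) /=.
have [ltin ltjn] := (ltn_ord i, ltn_ord j).
have [ltij|leji] := ltnP i j; last first.
  rewrite (_ : i + (n - j) = (i - j) + n)%N; last by lia.
  rewrite modnDr modn_small; lia.
rewrite modn_small; lia.
Qed.

Lemma cycle_offset_ordS (n : nat) (j i : 'I_n) :
  cycle_offset j (ordS i) = ((cycle_offset j i).+1 %% n)%N.
Proof. by rewrite /cycle_offset /= modnDml -[in RHS]addn1 modnDml addn1 addSn. Qed.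

Lemma cycle_offset_ord_pred (n : nat) (j i : 'I_n) :
  cycle_offset j (ord_pred i) = ((cycle_offset j i + n.-1) %% n)%N.
Proof.
rewrite /cycle_offset /= !modnDml; congr (_ %% _)%N.
by have := ltn_ord i; lia.
Qed.

(** The root [r > 1] of [r + 1/r - 2 = 1/(d n)^2].  With [x = 1/(2 d n)] it is the
square of [x + sqrt (1 + x^2)], whose inverse is [sqrt (1 + x^2) - x]. *)
Definition growth (R : realType) (d : R) (n : nat) : R :=
  let x := (2 * d * n%:R)^-1 in (x + Num.sqrt (1 + x ^+ 2)) ^+ 2.

(** The Green function with source [j] of the operator [- d^2 n^2 L + 1] on the
cycle with [n >= 2] nodes, evaluated at [i].  The numerator is invariant under [l |-> n - l], so the
offset may be used in place of the graph distance. *)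
Definition discrete_green (R : realType) (d : R) (n : nat) (j i : 'I_n) : R :=
  let r := growth d n in let l := cycle_offset j i in
  (r ^+ l + r ^+ (n - l))
    / (d ^+ 2 * n%:R ^+ 2 * ((r - r^-1) * (r ^+ n - 1))).

(** [r ^ l] and [r ^ (n - l)] solve the homogeneous three-term recurrence; their
sum is [n]-periodic in [l] with a kink at [l = 0], which gives the source term. *)
Lemma cycle_lap_pow (F : fieldType) (r : F) (n : nat) (j i : 'I_n) :
  (1 < n)%N -> r != 0 ->
  let f i := r ^+ cycle_offset j i + r ^+ (n - cycle_offset j i) in
  cycle_lap f i - (r + r^-1 - 2) * f i
    = - ((r - r^-1) * (r ^+ n - 1)) *+ (i == j).
Proof.
move=> n1 r0 f; rewrite /cycle_lap /f cycle_offset_ordS cycle_offset_ord_pred.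
rewrite -cycle_offset_eq0; have := cycle_offset_lt j i.
move: (cycle_offset j i) => l ltln {i j f}.
have -> : r ^+ (l.+1 %% n) + r ^+ (n - l.+1 %% n)
    = r * r ^+ l + r^-1 * r ^+ (n - l).
  have -> : r^-1 * r ^+ (n - l) = r ^+ (n - l.+1).
    by rewrite (_ : (n - l)%N = (n - l.+1).+1) ?exprS ?mulKf //; lia.
  rewrite -exprS; have [Sl|ltSl] := eqVneq l.+1 n.
    by rewrite Sl modnn subn0 subnn addrC.
  by rewrite modn_small //; lia.
case: l ltln => [|l] ltln /=.
  rewrite add0n modn_small ?prednK ?subn0 ?mulr1n ?expr0 //; try lia.
  rewrite (_ : (n - n.-1)%N = 1%N) ?expr1; last by lia.
  have -> : r ^+ n.-1 = r^-1 * r ^+ n.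
    by rewrite -{2}(@prednK n) ?exprS ?mulKf //; lia.
  by field.
rewrite mulr0n (_ : (l.+1 + n.-1)%N = (l + n)%N); last by lia.
rewrite modnDr modn_small; last by lia.
have -> : (n - l)%N = (n - l.+1).+1 by lia.
rewrite !exprS; by field.
Qed.

Section Growth.
(* [s ^ 2 = 1 + x ^ 2], and [growth d n] is [(x + s) ^ 2]. *)
Variables (R : realType) (d : R) (n : nat).
Hypotheses (d_gt0 : 0 < d) (n_gt0 : (0 < n)%N).
Let x := (2 * d * n%:R)^-1.
Let s := Num.sqrt (1 + x ^+ 2).

Let x_gt0 : 0 < x. Proof. by rewrite invr_gt0 !mulr_gt0 ?ltr0n. Qed.

Let s2 : s ^+ 2 = 1 + x ^+ 2.
Proof. by rewrite sqr_sqrtr // addr_ge0 ?sqr_ge0. Qed.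

Let s_ge1 : 1 <= s.
Proof. by rewrite -[leLHS]sqrtr1 ler_wsqrtr // lerDl sqr_ge0. Qed.

Let s_le : s <= 1 + x ^+ 2.
Proof. by rewrite -s2 expr2 ler_peMl // (le_trans ler01). Qed.

Let q_gt1 : 1 < x + s. Proof. by have := (x_gt0, s_ge1) => -[]; lra. Qed.

Let qV : (x + s)^-1 = s - x.
Proof.
apply: (@mulfI _ (x + s)); first by rewrite gt_eqF // (lt_trans ltr01).
rewrite mulfV; last by rewrite gt_eqF // (lt_trans ltr01).
by move: s2; rewrite !expr2; lra.
Qed.

Lemma growth_gt1 : 1 < growth d n.
Proof. by rewrite /growth exprn_egt1. Qed.

Lemma growth_char : growth d n + (growth d n)^-1 - 2 = (d ^+ 2 * n%:R ^+ 2)^-1.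
Proof.
rewrite /growth -exprVn -/x -/s qV.
have -> : (d ^+ 2 * n%:R ^+ 2)^-1 = 4 * x ^+ 2.
  by rewrite /x; field; rewrite pnatr_eq0 -lt0n n_gt0 gt_eqF.
by rewrite sqrrD sqrrB s2; ring.
Qed.

(** The middle term equals [2 d s], which tends to [2 d]. *)
Lemma growth_gap_bounds :
  2 * d <= d ^+ 2 * n%:R * (growth d n - (growth d n)^-1)
    <= 2 * d * (1 + x ^+ 2).
Proof.
have -> : d ^+ 2 * n%:R * (growth d n - (growth d n)^-1) = 2 * d * s.
  rewrite /growth -exprVn -/x -/s qV.
  rewrite (_ : _ - _ = 4 * x * s); last by ring.
  by rewrite /x; field; rewrite pnatr_eq0 -lt0n n_gt0 gt_eqF.
have d2 : 0 <= 2 * d by rewrite mulr_ge0 // ltW.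
by rewrite ler_peMr //= ler_wpM2l.
Qed.

(** The middle term tends to [1/d].  The bounds come from
[1 - 1/q <= ln q <= q - 1] at [q = x + s]. *)
Lemma ln_growth_bounds :
  d^-1 * (1 - x) <= n%:R * ln (growth d n) <= d^-1 * (1 + x).
Proof.
have q0 : 0 < x + s by rewrite (lt_trans ltr01).
have -> : n%:R * ln (growth d n) = d^-1 * (ln (x + s) / x).
  rewrite /growth -/x -/s lnXn // -mulr_natl /x; field.
  by rewrite pnatr_eq0 -lt0n n_gt0 gt_eqF.
rewrite !ler_pM2l ?invr_gt0 // (ler_pdivlMr _ _ x_gt0) (ler_pdivrMr _ _ x_gt0).
apply/andP; split.
  have : ln (1 + (s - x - 1)) <= s - x - 1.
    by rewrite le_ln1Dx // -qV ltrBrDr addNr invr_gt0.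
  rewrite (_ : 1 + (s - x - 1) = (x + s)^-1); last by rewrite qV; ring.
  by rewrite lnV ?posrE //; move: s_le; lra.
have : ln (1 + (x + s - 1)) <= x + s - 1.
  by rewrite le_ln1Dx // ltrBrDr addNr.
rewrite (_ : 1 + (x + s - 1) = x + s); last by ring.
by move: s_le; lra.
Qed.

End Growth.

Lemma discrete_greenP (R : realType) (d : R) (n : nat) (j i : 'I_n) :
  0 < d -> (1 < n)%N ->
  d ^+ 2 * n%:R ^+ 2 * cycle_lap (discrete_green d j) i - discrete_green d j i
    = - (i == j)%:R.
Proof.
move=> d0 n1; have n0 : (0 < n)%N by lia.
have r1 := growth_gt1 d0 n0; have r0 : 0 < growth d n by rewrite (lt_trans ltr01).
have D0 : (growth d n - (growth d n)^-1) * (growth d n ^+ n - 1) != 0.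
  rewrite mulf_neq0 // subr_eq0 gt_eqF //; last by rewrite exprn_egt1 // -lt0n.
  by rewrite (lt_trans _ r1) // invf_lt1.
have := cycle_lap_pow j i n1 (lt0r_neq0 r0).
rewrite growth_char //; set D := _ * (_ - 1) in D0 *.
set f := fun i : 'I_n => _; set A := d ^+ 2 * _ => lap_f.
have A0 : A != 0 by rewrite mulf_neq0 ?expf_neq0 ?gt_eqF ?ltr0n.
have -> : cycle_lap (discrete_green d j) i = cycle_lap f i / (A * D).
  by rewrite /cycle_lap mulrBl mulrDl mulrnAl.
rewrite (_ : discrete_green d j i = f i / (A * D)) //.
rewrite (_ : _ - _ = (cycle_lap f i - A^-1 * f i) / D); last first.
  by field; rewrite A0 D0.
by rewrite lap_f mulNrn mulNr mulrnAl divff.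
Qed.

(** * Convergence to the periodic Green function *)

(** [n] times the discrete Green function at two nodes at distance [a] on the
circle, with the powers [r ^ (a n)] and [r ^ ((1 - a) n)] written as exponentials
so that [a] may be any real number. *)
Definition scaled_green (R : realType) (d a : R) (n : nat) : R :=
  let r := growth d n in let t := n%:R * ln r in
  (expR (a * t) + expR ((1 - a) * t))
    / (d ^+ 2 * n%:R * (r - r^-1) * (expR t - 1)).

Lemma at_point_offset (R : realType) (n : nat) (y z : R) (i j : 'I_n) :
  at_point y i -> at_point z j ->
  exists m : int, y - z = (cycle_offset j i)%:R / n%:R + m%:~R.
Proof.
move=> [m1 ->] [m2 ->]; have ltjn := ltn_ord j.
have n0 : n%:R != 0 :> R by rewrite pnatr_eq0; lia.
exists (((i + (n - j)) %/ n)%N%:Z - 1 + m1 - m2).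
have /(congr1 (fun k => k%:R : R)) := divn_eq (i + (n - j)) n.
rewrite -/(cycle_offset j i) !natrD natrM natrB 1?ltnW // => Eij.
rewrite !intrD !rmorphN /= -pmulrn.
suff -> : (cycle_offset j i)%:R = i%:R + (n%:R - j%:R)
    - ((i + (n - j)) %/ n)%:R * n%:R :> R by field.
by rewrite Eij; ring.
Qed.

Lemma discrete_green_at_points (R : realType) (d : R) (n : nat) (y z : R)
    (i j : 'I_n) :
  0 < d -> at_point y i -> at_point z j -> `|y - z| < 1 ->
  n%:R * discrete_green d j i = scaled_green d `|y - z| n.
Proof.
move=> d0 yi zj lt_yz; have n0 : (0 < n)%N by have := ltn_ord j; lia.
have nR : 0 < n%:R :> R by rewrite ltr0n.
have r0 : 0 < growth d n by rewrite (lt_trans ltr01) ?growth_gt1.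
have [m Em] := at_point_offset yi zj.
have ltln := cycle_offset_lt j i.
set l := cycle_offset j i in Em ltln.
have powE k (a : R) : k%:R = a * n%:R ->
    growth d n ^+ k = expR (a * (n%:R * ln (growth d n))).
  by move=> Ek; rewrite mulrA -Ek expRM_natl lnK.
have l_ge0 : 0 <= l%:R / n%:R :> R by rewrite divr_ge0.
have l_lt1 : l%:R / n%:R < 1 :> R by rewrite ltr_pdivrMr // mul1r ltr_nat.
have lE : l%:R = l%:R / n%:R * n%:R :> R by rewrite divfK ?gt_eqF.
have nlE : (n - l)%:R = (1 - l%:R / n%:R) * n%:R :> R.
  by rewrite natrB 1?ltnW // mulrBl mul1r -lE.
(* [y - z] lies in (-1, 1) and differs from [l / n] in [0, 1) by an integer, which
   is therefore 0 or -1. *)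
have dist : `|y - z| = l%:R / n%:R \/ `|y - z| = 1 - l%:R / n%:R.
  move: lt_yz; rewrite ltr_norml => /andP[y1 y2].
  have m1 : m%:~R < 1%:~R :> R by lra.
  have m2 : (-2)%:~R < m%:~R :> R by rewrite intrN; lra.
  rewrite !ltr_int in m1 m2.
  have [m0|m0] : m = 0 \/ m = -1 by lia.
    by left; rewrite Em m0 addr0 ger0_norm.
  right; rewrite Em m0 intrN ltr0_norm; last by lra.
  by rewrite opprB.
set t := n%:R * ln (growth d n) in powE.
have numE : expR (`|y - z| * t) + expR ((1 - `|y - z|) * t)
    = expR (l%:R / n%:R * t) + expR ((1 - l%:R / n%:R) * t).
  by case: dist => ->; [|rewrite (subKr 1 (l%:R / n%:R)) addrC].
have scaleE (c e : R) : n%:R * (d ^+ 2 * n%:R ^+ 2 * (c * e))^-1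
    = (d ^+ 2 * n%:R * c * e)^-1.
  by rewrite !invfM; move: c^-1 e^-1 => c' e'; field; rewrite !gt_eqF.
rewrite /discrete_green /scaled_green /= -/l (powE _ _ lE) (powE _ _ nlE).
rewrite (powE n 1) ?mul1r //.
by rewrite -/t numE mulrCA scaleE.
Qed.

(** The hyperbolic functions expanded; the minimum disappears because [cosh] is
even. *)
Lemma GperE (R : realType) (d y z : R) :
  0 < d ->
  Gper d y z = (expR (`|y - z| * d^-1) + expR ((1 - `|y - z|) * d^-1))
                 / (2 * d * (expR d^-1 - 1)).
Proof.
move=> d0; have d1 : d != 0 by rewrite gt_eqF.
rewrite /Gper /=; set a := `|y - z|.
have -> : cosh ((Num.min a (1 - a) - 1 / 2) / d) = cosh ((a - 1 / 2) / d).
  rewrite /Order.min; case: ifP => // _.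
  rewrite /cosh addrC; congr ((expR _ + expR _) / _); by field.
pose e := expR (1 / (2 * d)); have e0 : e != 0 by rewrite gt_eqF // expR_gt0.
pose b := expR (a / d); have b0 : b != 0 by rewrite gt_eqF // expR_gt0.
have -> : expR d^-1 = e ^+ 2.
  by rewrite -expRM_natl; congr expR; field.
have -> : expR ((1 - a) * d^-1) = e ^+ 2 / b.
  by rewrite -expRM_natl -expRB; congr expR; field.
have e1 : 1 < e by rewrite expR_gt1 divr_gt0 ?mulr_gt0.
have e2 : e ^+ 2 - 1 != 0 by rewrite subr_eq0 gt_eqF // exprn_egt1.
have -> : cosh ((a - 1 / 2) / d) = (b / e + e / b) / 2.
  rewrite /cosh expRN -[in RHS](invf_div b) /b /e -expRB.
  by congr ((expR _ + (expR _)^-1) / _); field.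
rewrite /sinh expRN -/e -/b; field.
by rewrite e2 d1 e0 b0.
Qed.

Lemma scaled_green_cvg (R : realType) (d y z : R) :
  0 < d -> scaled_green d `|y - z| n @[n --> \oo] --> Gper d y z.
Proof.
move=> d0; have d1 : d != 0 by rewrite gt_eqF.
pose x n : R := (2 * d * n%:R)^-1.
have x0 : x n @[n --> \oo] --> (0 : R).
  have inv0 : (n%:R : R)^-1 @[n --> \oo] --> (0 : R).
    apply/gtr0_cvgV0; last exact: cvgr_idn.
    by near=> n; rewrite ltr0n; near: n; exact: nbhs_infty_gt.
  have -> : x = (fun n => (2 * d)^-1 * n%:R^-1).
    by apply/funext => n; rewrite /x invfM.
  by rewrite -(mulr0 (2 * d)^-1); apply: cvgM inv0; exact: cvg_cst.
have tn : n%:R * ln (growth d n) @[n --> \oo] --> d^-1.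
  apply: (@squeeze_cvgr _ _ _ _ (fun n => d^-1 * (1 - x n))
                                (fun n => d^-1 * (1 + x n))).
  - near=> n; apply: ln_growth_bounds => //.
    by near: n; exact: nbhs_infty_gt.
  - have lim : d^-1 * (1 - x n) @[n --> \oo] --> d^-1 * (1 - 0).
      by apply: cvgM; [exact: cvg_cst|apply: cvgB x0; exact: cvg_cst].
    by rewrite subr0 mulr1 in lim.
  - have lim : d^-1 * (1 + x n) @[n --> \oo] --> d^-1 * (1 + 0).
      by apply: cvgM; [exact: cvg_cst|apply: cvgD x0; exact: cvg_cst].
    by rewrite addr0 mulr1 in lim.
have gapn : d ^+ 2 * n%:R * (growth d n - (growth d n)^-1)
    @[n --> \oo] --> 2 * d.
  apply: (@squeeze_cvgr _ _ _ _ (fun=> 2 * d)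
                                (fun n => 2 * d * (1 + x n ^+ 2))).
  - near=> n; apply: growth_gap_bounds => //.
    by near: n; exact: nbhs_infty_gt.
  - exact: cvg_cst.
  - have lim : 2 * d * (1 + x n ^+ 2) @[n --> \oo] --> 2 * d * (1 + 0 * 0).
      apply: cvgM; first exact: cvg_cst.
      by apply: cvgD; [exact: cvg_cst|exact: cvgM].
    by rewrite mulr0 addr0 mulr1 in lim.
rewrite GperE // /scaled_green /=.
have expn c : expR (c * (n%:R * ln (growth d n))) @[n --> \oo]
    --> expR (c * d^-1).
  apply: continuous_cvg; first exact: continuous_expR.
  by apply: cvgM => //; exact: cvg_cst.
apply: cvgM; first by apply: cvgD; exact: expn.
apply: cvgV.
  rewrite !mulf_neq0 // subr_eq0 gt_eqF // expR_gt1 invr_gt0 //.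
apply: cvgM => //; apply: cvgB; last exact: cvg_cst.
by apply: continuous_cvg; first exact: continuous_expR.
Unshelve. all: by end_near. Qed.

Lemma GperC (R : realType) (d y z : R) : Gper d y z = Gper d z y.
Proof. by rewrite /Gper distrC. Qed.

Lemma cvg_Gper (R : realType) (T : Type) (F : set_system T) (FF : Filter F)
    (d : R) (f g : T -> R) (y z : R) :
  0 < d -> f t @[t --> F] --> y -> g t @[t --> F] --> z ->
  Gper d (f t) (g t) @[t --> F] --> Gper d y z.
Proof.
move=> d0 fy gz; rewrite GperE //.
have dist : `|f t - g t| @[t --> F] --> `|y - z| by apply: cvg_norm; exact: cvgB.
have expn (a : T -> R) (l : R) : a t @[t --> F] --> l ->
    expR (a t * d^-1) @[t --> F] --> expR (l * d^-1).
  move=> al; apply: continuous_cvg; first exact: continuous_expR.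
  by apply: cvgM => //; exact: cvg_cst.
under eq_cvg do rewrite GperE //.
apply: cvgM; last exact: cvg_cst.
by apply: cvgD; apply: expn => //; apply: cvgB => //; exact: cvg_cst.
Qed.

(** * Nodes representing points of the circle *)

Lemma at_point_unique (R : realType) (n : nat) (y : R) (i i' : 'I_n) :
  at_point y i -> at_point y i' -> i = i'.
Proof.
move=> yi yi'; have n0 : 0 < n%:R :> R by rewrite ltr0n; have := ltn_ord i; lia.
have [m] := at_point_offset yi yi'; rewrite subrr => Em.
have lt_l := cycle_offset_lt i' i.
apply/eqP; rewrite -cycle_offset_eq0.
have l_ge0 : 0 <= (cycle_offset i' i)%:R / n%:R :> R by rewrite divr_ge0 // ltW.
have l_lt1 : (cycle_offset i' i)%:R / n%:R < 1 :> R.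
  by rewrite ltr_pdivrMr // mul1r ltr_nat.
have m1 : m%:~R < 1%:~R :> R by lra.
have m2 : (-1)%:~R < m%:~R :> R by rewrite intrN; lra.
rewrite !ltr_int in m1 m2.
have m0 : m = 0 by lia.
move: Em; rewrite m0 addr0 => /esym/eqP.
by rewrite mulf_eq0 invr_eq0 (gt_eqF n0) orbF pnatr_eq0.
Qed.

(** Two points at distance less than 1 that are represented by the same node are
equal as real numbers. *)
Lemma at_point_inj (R : realType) (n : nat) (y z : R) (i : 'I_n) :
  at_point y i -> at_point z i -> `|y - z| < 1 -> y = z.
Proof.
move=> yi zi; have [m] := at_point_offset yi zi.
have /eqP -> : cycle_offset i i == 0%N by rewrite cycle_offset_eq0.
rewrite mul0r add0r => Em; rewrite Em ltr_norml => /andP[m1 m2].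
have {}m1 : (-1)%:~R < m%:~R :> R by rewrite intrN.
have {}m2 : m%:~R < 1%:~R :> R by [].
rewrite !ltr_int in m1 m2.
have m0 : m = 0 by lia.
by apply/eqP; rewrite -subr_eq0 Em m0.
Qed.

(** * Reduction of the linearized problem to the spikes *)

(** From an eigenvector [w] of the reduced matrix, acting on rows, take [phi] equal
to [w_k] at the [k]-th spike and to 0 elsewhere, and [psi] the solution of the
second equation given by the Green function. *)
Lemma unstable_spike_mx (R : realType) (n K : nat) (d : R)
    (pos : 'I_K -> 'I_n) (u v : 'I_n -> R) :
  0 < d -> (1 < n)%N -> injective pos -> (forall i, 0 < v i) ->
  (forall k, u (pos k) = v (pos k)) ->
  (forall i, (forall k, i <> pos k) -> u i = 0) ->
  unstable_mx (\matrix_(k, j) ((k == j)%:R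
    - 2 * v (pos k) * discrete_green d (pos k) (pos j))) ->
  unstable d u v.
Proof.
move=> d0 n1 pos_inj v0 uv u0 [lam /eigenvalueP[w Ew wn0] lam0].
pose C := real_complex R.
pose phi i : R[i] := \sum_k w 0 k *+ (i == pos k).
pose psi i : R[i] := \sum_k C (2 * v (pos k) * discrete_green d (pos k) i) * w 0 k.
have phi_pos j : phi (pos j) = w 0 j.
  rewrite /phi (bigD1 j) //= eqxx mulr1n big1 ?addr0 // => k kj.
  by rewrite (inj_eq pos_inj) eq_sym (negbTE kj).
have Ej j : lam * w 0 j = w 0 j - psi (pos j).
  have /rowP/(_ j) := Ew; rewrite !mxE => <-.
  rewrite /psi (eq_bigr (fun k => w 0 k *+ (k == j)
      - C (2 * v (pos k) * discrete_green d (pos k) (pos j)) * w 0 k)).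
    rewrite sumrB (bigD1 j) //= eqxx mulr1n big1 ?addr0 // => k kj.
    by rewrite (negbTE kj).
  move=> k _; rewrite !mxE rmorphB /= mulrBr [w 0 k * _]mulrC; congr (_ - _).
    by case: (k == j); rewrite ?rmorph1 ?rmorph0 ?mul1r ?mul0r.
  by rewrite mulrC.
exists lam, phi, psi; split=> //.
- have /rV0Pn[k wk] := wn0.
  by exists (pos k); rewrite xpair_eqE phi_pos negb_and wk.
- move=> i; have [[k ->]|nspike] := pselect (exists k, i = pos k).
    rewrite phi_pos Ej uv divff ?expf_neq0 ?gt_eqF // mulfK ?gt_eqF //.
    by rewrite rmorph1 rmorph_nat mul1r; ring.
  have npos k : i <> pos k by move=> ik; apply: nspike; exists k.
  rewrite u0 // /phi big1; first by rewrite !(mulr0, mul0r, rmorph0, expr0n) /=; ring.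
  by move=> k _; case: eqP => // /npos.
move=> i.
have -> : cycle_lap psi i = \sum_k C (2 * v (pos k)
    * cycle_lap (discrete_green d (pos k)) i) * w 0 k.
  rewrite /cycle_lap /psi -big_split -sumrMnl -sumrB; apply: eq_bigr => k _ /=.
  by rewrite /C mulrBr mulrDr mulrnAr rmorphB rmorphD rmorphMn /=; ring.
rewrite mulr_sumr -sumrB mulr_sumr -big_split big1 //= => k _.
have := discrete_greenP (pos k) i d0 n1.
move: (_ * n%:R ^+ 2) (cycle_lap _ _) (discrete_green _ _ _) => A L G E.
rewrite !mulrA -!rmorphM /= -mulrBl -rmorphB /=.
rewrite (_ : _ - _ = 2 * v (pos k) * (A * L - G)); last by ring.
rewrite E; case: eqP => [->|_].
  by rewrite uv mulrN1 rmorphN mulNr addNr.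
by rewrite oppr0 mulr0 rmorph0 mul0r mulr0 addr0.
Qed.

(** * The limit of many nodes and the limit of small deviations *)

Lemma cvg_div_nat (R : realType) (D : set nat) (f : nat -> R) (c : R) :
  f ~_(within D \oo) (fun n => n%:R * c) ->
  f n / n%:R @[n --> within D \oo] --> c.
Proof.
move=> /eqaddoP small; apply/cvgrPdist_le => e e0.
have c1 : 0 < `|c| + 1 by rewrite ltr_wpDl.
have [n_gt0 near_small] : (\forall n \near within D \oo, (0 < n)%N) /\
  \forall n \near within D \oo, `|f n - n%:R * c| <= e / (`|c| + 1) * `|n%:R * c|.
  split; first by apply: cvg_within; exact: nbhs_infty_gt.
  by apply: small; rewrite divr_gt0.
apply: filterS2 n_gt0 near_small => n n0.
have nR : 0 < n%:R :> R by rewrite ltr0n.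
rewrite distrC normrM ger0_norm // => le_f.
rewrite (_ : c - _ = (n%:R * c - f n) / n%:R); last by field; rewrite gt_eqF.
rewrite normrM normfV (ger0_norm (ltW nR)) ler_pdivrMr // (le_trans le_f) //.
rewrite (_ : _ / _ * _ = e * n%:R * (`|c| / (`|c| + 1))); last first.
  by field; rewrite gt_eqF.
rewrite ler_piMr ?mulr_ge0 ?(ltW e0) ?(ltW nR) //.
by rewrite ler_pdivrMr // mul1r lerDl.
Qed.

Section DeviatingPositions.
Variables (R : realType) (K : nat) (s : 'I_K -> R).

Lemma cvg_dev_pos k : dev_pos s sigma k @[sigma --> 0^'+] --> sym_pos R k.
Proof.
have lim : sym_pos R k + sigma * s k @[sigma --> 0^'+]
    --> sym_pos R k + 0 * s k.
  apply: cvgD; first exact: cvg_cst.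
  by apply: cvgM; [exact: cvg_at_right_filter|exact: cvg_cst].
by rewrite mul0r addr0 in lim.
Qed.

Lemma sym_pos_dist_lt1 (k j : 'I_K) : `|sym_pos R k - sym_pos R j| < 1.
Proof.
have K0 : 0 < K%:R :> R by rewrite ltr0n; have := ltn_ord k; lia.
have pos01 (i : 'I_K) : 0 <= sym_pos R i < 1.
  by rewrite /sym_pos divr_ge0 //= ltr_pdivrMr // mul1r ltr_nat.
have /andP[k0 k1] := pos01 k; have /andP[j0 j1] := pos01 j.
by rewrite ltr_norml; apply/andP; split; lra.
Qed.

Lemma sym_pos_inj : injective (@sym_pos R K).
Proof.
move=> k j; have K0 : K%:R != 0 :> R.
  by rewrite pnatr_eq0; have := ltn_ord k; lia.
move=> /(mulIf (invr_neq0 K0))/eqP; rewrite eqr_nat => /eqP kj.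
exact: val_inj.
Qed.

(** For small [sigma] the spikes have distinct positions on the circle, and
distances less than 1, as the formula for [Gper] requires. *)
Lemma dev_pos_separated :
  \forall sigma \near 0^'+, forall k j : 'I_K,
    `|dev_pos s sigma k - dev_pos s sigma j| < 1
    /\ (k != j -> dev_pos s sigma k != dev_pos s sigma j).
Proof.
apply: filter_forall => k; apply: filter_forall => j.
have lim : `|dev_pos s sigma k - dev_pos s sigma j| @[sigma --> 0^'+]
    --> `|sym_pos R k - sym_pos R j|.
  by apply: cvg_norm; apply: cvgB; exact: cvg_dev_pos.
have near_lt : \forall sigma \near 0^'+,
    `|dev_pos s sigma k - dev_pos s sigma j| < 1.
  exact: cvgr_lt lim _ (sym_pos_dist_lt1 k j).
have [<-|kj] := eqVneq k j; first by apply: nearW => sigma; rewrite subrr normr0 ltr01.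
have dist_gt0 : 0 < `|sym_pos R k - sym_pos R j|.
  by rewrite normr_gt0 subr_eq0 (inj_eq sym_pos_inj).
have near_gt : \forall sigma \near 0^'+,
    0 < `|dev_pos s sigma k - dev_pos s sigma j|.
  exact: cvgr_gt lim _ dist_gt0.
near=> sigma; split=> [|_]; first by near: sigma.
by rewrite -subr_eq0 -normr_gt0; near: sigma.
Unshelve. all: by end_near. Qed.

End DeviatingPositions.

Lemma limit_heights_cvg (R : realType) (K : nat) (d : R) (s : 'I_K -> R)
    (V : R -> 'I_K -> R) (k : 'I_K) :
  limit_heights d s V -> V sigma k @[sigma --> 0^'+] --> sym_height K d.
Proof.
move=> [_ /(_ k)/eqO_exP[c c0 near_c]].
apply/subr_cvg0; apply: (@squeeze_cvgr _ _ _ _ (fun x => - (c * `|x|))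
                           (fun x => c * `|x|)).
- by apply: filterS near_c => x /=; rewrite ler_norml.
- have lim : - (c * `|x|) @[x --> 0^'+] --> - (c * `|0 : R|).
    apply: cvgN; apply: cvgM; first exact: cvg_cst.
    by apply: cvg_norm; exact: cvg_at_right_filter.
  by rewrite normr0 mulr0 oppr0 in lim.
have lim : c * `|x| @[x --> 0^'+] --> c * `|0 : R|.
  apply: cvgM; first exact: cvg_cst.
  by apply: cvg_norm; exact: cvg_at_right_filter.
by rewrite normr0 mulr0 in lim.
Qed.

(** The leading-order matrix of the linearization at spikes with positions [y] and
heights [n V].  Its transpose multiplies the column of the values of [phi] at the
spikes. *)
Definition dev_matrix (R : realType) (K : nat) (d : R) (y V : 'I_K -> R) :
    'M[R]_K :=
  \matrix_(k, j) ((k == j)%:R - 2 * V k * Gper d (y j) (y k)).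

Lemma sym_matrixE (R : realType) (K : nat) (d : R) :
  sym_matrix K d = dev_matrix d (@sym_pos R K) (fun=> sym_height K d).
Proof. by apply/matrixP => k j; rewrite !mxE [X in _ - _ * X]GperC. Qed.

Lemma dev_matrix_cvg (R : realType) (K : nat) (d : R) (T : Type)
    (F : set_system T) (FF : Filter F) (y V : T -> 'I_K -> R)
    (y0 V0 : 'I_K -> R) (e : R) :
  0 < d -> 0 < e ->
  (forall k, y t k @[t --> F] --> y0 k) ->
  (forall k, V t k @[t --> F] --> V0 k) ->
  \forall t \near F, forall k j,
    `|dev_matrix d y0 V0 k j - dev_matrix d (y t) (V t) k j| < e.
Proof.
move=> d0 e0 yl Vl; apply: filter_forall => k; apply: filter_forall => j.
apply: cvgr_dist_lt e0; rewrite mxE; under eq_cvg do rewrite mxE.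
apply: cvgB; first exact: cvg_cst.
apply: cvgM; last exact: cvg_Gper.
by apply: cvgM; [exact: cvg_cst|exact: Vl].
Qed.

Unset Implicit Arguments.

Theorem mainTheorem8 (R : realType) (K : nat) (hK : (2 <= K)%N) (d : R) (hd : 0 < d)
    (hsym : sym_unstable K d) (s : 'I_K -> R) (V : R -> 'I_K -> R)
    (hV : limit_heights d s V) :
  \forall sigma \near 0^'+,
    forall (u v : forall n : nat, 'I_n -> R) (h : nat -> 'I_K -> R),
      let y := dev_pos s sigma in
      let D := [set n | [/\ admissible y n, spike_steady_state d y (u n) (v n)
                          & has_heights y (h n) (u n)]] in
      (forall k, (fun n => h n k) ~_ (within D \oo) (fun n => n%:R * V sigma k)) ->
      \forall n \near \oo, D n -> unstable d (u n) (v n).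
Proof.
have [e e0 open_sym] := unstable_mx_open hsym.
have near_sym : \forall sigma \near 0^'+, forall k j,
    `|sym_matrix K d k j - dev_matrix d (dev_pos s sigma) (V sigma) k j| < e.
  rewrite sym_matrixE; apply: dev_matrix_cvg => // k; first exact: cvg_dev_pos.
  exact: limit_heights_cvg hV.
near=> sigma; set y := dev_pos s sigma.
have sep : forall k j, `|y k - y j| < 1 /\ (k != j -> y k != y j).
  by rewrite /y; near: sigma; exact: dev_pos_separated.
have dev_sym : forall k j, `|sym_matrix K d k j - dev_matrix d y (V sigma) k j| < e.
  by rewrite /y; near: sigma.
move=> u v h; set D := [set n | _] => hh.
have {dev_sym} [e' e'0 open_dev] :
    exists2 e', 0 < e' & forall A : 'M[R]_K,
      (forall k j, `|dev_matrix d y (V sigma) k j - A k j| < e') ->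
      unstable_mx A.
  by apply: unstable_mx_open; exact: open_sym.
(* The hypothesis on the heights holds along [D] only, whence the filter. *)
have near_n : \forall n \near within D \oo, forall k j,
    `|dev_matrix d y (V sigma) k j
      - ((k == j)%:R - 2 * (h n k / n%:R) * scaled_green d `|y j - y k| n)| < e'.
  apply: filter_forall => k; apply: filter_forall => j.
  apply: cvgr_dist_lt e'0; rewrite mxE.
  apply: cvgB; first exact: cvg_cst.
  apply: cvgM; first by apply: cvgM; [exact: cvg_cst|exact: cvg_div_nat].
  by apply: cvg_within_filter; exact: scaled_green_cvg.
apply: filterS2 (nbhs_infty_gt 1) near_n => n n1 near_n Dn.
have [adm [_ v0 uv u0] hu] := Dn.
have [pos posP] := choice adm.
apply: (@unstable_spike_mx _ _ _ _ pos _ _ hd n1 _ v0).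
- move=> k j pos_kj; apply/eqP; apply: contraT => kj.
  have yj := posP j; rewrite -pos_kj in yj.
  have [lt1 /(_ kj)/eqP[]] := sep k j.
  exact: at_point_inj (posP k) yj lt1.
- by move=> k; exact: uv (posP k).
- move=> i npos; apply: u0 => k yi; apply: (npos k).
  exact: at_point_unique yi (posP k).
apply: open_dev => k j; rewrite [X in `|_ - X|]mxE.
(* Compare [(v / n) * (n * G)] with [v * G]. *)
have n0 : n%:R != 0 :> R by rewrite pnatr_eq0; lia.
have := near_n Dn k j.
rewrite -(discrete_green_at_points hd (posP j) (posP k)); last by have [] := sep j k.
rewrite -(hu k _ (posP k)) (uv k _ (posP k)).
by rewrite [_ * _ * (n%:R * _)]mulrA -[2 * _ * n%:R]mulrA divfK.
Unshelve. all: by end_near. Qed.
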